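(* For every $S\subset [0,1]$ with $\lambda(S)=1$ there exist a strictly increasing function $f:[0,1]\to[0,1]$ and a set $N\subset S$ with $\lambda(N)=0$ such that $\lambda(f(N))=1$.
   Context: $\lambda$ denotes the Lebesgue measure on the real line; writing $\lambda(S)=1$ includes that $S$ is Lebesgue measurable. *)

(* Defs.v *)
From HB Require Import structures.
From mathcomp Require Import all_boot all_order all_algebra.
From mathcomp Require Import all_classical all_reals all_analysis.
Set Implicit Arguments.
Unset Strict Implicit.
Unset Printing Implicit Defensive.

(* The canonical measurable structure on R in the library is the Borel one, so
   Lebesgue measurability is Caratheodory measurability for the outer measure
   generated by interval length; this is the domain sigma-algebra of
   [completed_lebesgue_measure], and [completed_caratheodory_measurable]
   identifies it with the completion of the Borel sets. *)
Definition lebesgue_measurable (R : realType) : set (set R) :=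
  ((@wlength R idfun)^*%mu).-cara.-measurable.

(* [completed_lebesgue_measure] is a total function (the outer measure), hence
   the measurability conjunct. *)
Definition has_lebesgue_measure (R : realType) (A : set R) (v : \bar R) : Prop :=
  lebesgue_measurable A /\ completed_lebesgue_measure A = v.

(* Main.v *)
Require Import Defs.
From HB Require Import structures.
From mathcomp Require Import all_boot all_order all_algebra.
From mathcomp Require Import all_classical all_reals all_analysis.
From mathcomp Require Import measurable_realfun.
Import Order.TTheory GRing.Theory Num.Theory.
Import numFieldNormedType.Exports.
Local Open Scope classical_set_scope.
Local Open Scope ring_scope.

(** If [nu] is an atomless probability measure on [0, 1] that charges every
    interval, its distribution function [F] is continuous and strictly
    increasing from [0, 1] to [0, 1], and it sends [nu] to Lebesgue measure;
    hence it maps every Borel set carrying [nu] onto a set of measure one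
    ([rcdf_image_conull]). It suffices to find such a [nu] carried by a
    Lebesgue-null subset of [S].

    A singular [nu0] of this kind on the line, carried by a null set [M] that
    is unrelated to [S], is built by hand ([exists_singular_prob]). The set [S]
    comes in only through a translation: by Fubini, for almost every [t] the
    translate of [nu0] by [t] gives no mass to the null set of points of [0, 1]
    missing from [S] ([exists_translate_null]). Conditioning this translate on
    [0, 1] gives [nu], which is carried by [N], the intersection of [M + t] with
    a Borel subset of [S] of measure one.

    The construction of [nu0] rests on a strictly increasing function [g] with
    null range ([increasing_null_range]): the distribution function of a
    discrete measure with dense support, whose jumps exhaust the interval
    [0, 1]. The image of the uniform law under [g] is atomless and carried by a
    null set, and mixing its translates along a dense sequence makes it charge
    every interval. *)

(** * A strictly increasing function with null range *)

Lemma dense_enumeration (R : realType) :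
  exists q : nat -> R,
    injective q /\ forall x y, x < y -> exists n, x < q n < y.
Proof.
have /card_set_bijP[e [_ einj esurj]] : ([set: nat] #= [set: rat])%card.
  by rewrite card_eq_sym; exact: card_rat.
exists (fun n => ratr (e n)); split.
  by move=> m n /fmorph_inj /einj; apply; rewrite inE.
move=> x y /rat_in_itvoo[r]; rewrite in_itv/= => xry.
by have [n _ en] := esurj r I; exists n; rewrite en.
Qed.

Lemma fully_supported_prob_nat (R : realType) :
  exists K : probability nat R, forall n, (0 < K [set n])%E.
Proof.
exists (poisson_prob (1 : R) 0%N) => n /=.
rewrite /poisson_prob ltr01 esum_set1 ?lee_fin ?poisson_pmf_ge0//.
by rewrite lte_fin /poisson_pmf ltr01 !mulr_gt0 ?exprn_gt0 ?expR_gt0//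
  ?invr_gt0 ?ltr0n ?fact_gt0.
Qed.

(** The distribution function [g] of a discrete measure charging a dense set of
    points [q n] is strictly increasing, and its jump at [q n] leaves in [0, 1]
    a gap as long as the mass of [q n]. These disjoint gaps have total length
    [1], the total mass, so what remains of [0, 1] is a null set containing the
    range of [g]. As [g] is injective, it transports Lebesgue measure to an
    atomless measure carried by a null set. *)
Lemma increasing_null_range (R : realType) :
  exists (g : R -> R) (C : set R),
    [/\ {homo g : x y / x < y}, measurable C, lebesgue_measure C = 0%E
      & forall y, C (g y)].
Proof.
have [q [qinj qdense]] := dense_enumeration R.
have [K K0] := fully_supported_prob_nat R.
have Kfin A : K A \is a fin_num by exact: fin_num_measure.
pose g y := fine (K [set n | q n < y]).
pose k n := fine (K [set n]).
have k0 n : 0 < k n by rewrite /k fine_gt0// K0 -ge0_fin_numE ?Kfin.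
have g0 y : 0 <= g y by rewrite /g fine_ge0.
have g1 y : g y <= 1.
  by rewrite /g -lee_fin fineK ?Kfin// probability_le1.
have jump n y : q n < y -> g (q n) + k n <= g y.
  move=> qy; rewrite /g /k -lee_fin EFinD !fineK ?Kfin// -measureU//.
    apply: le_measure; rewrite ?inE// => m [/= qm|/= ->//].
    exact: lt_trans qy.
  by rewrite -subset0 => m [/= qm mn]; move: qm; rewrite mn ltxx.
have gmono x y : x <= y -> g x <= g y.
  move=> xy; rewrite /g fine_le ?Kfin// le_measure ?inE// => n /= qx.
  exact: lt_le_trans xy.
pose G n := `]g (q n), g (q n) + k n[%classic : set R.
have Gg n y : ~ G n (g y).
  rewrite /G/= in_itv/= => /andP[]; have [qy|qy] := ltP (q n) y.
    by move=> _; rewrite ltNge jump.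
  by rewrite ltNge gmono.
have G01 n : G n `<=` `[0, 1].
  move=> z; rewrite /G/= !in_itv/= => /andP[gz zg].
  rewrite (le_trans (g0 _) (ltW gz))/= (le_trans (ltW zg))//.
  by rewrite (le_trans (jump n (q n + 1) _)) ?ltrDl.
have mG n : measurable (G n) by exact: measurable_itv.
have tG : trivIset setT G.
  have disj m n z : q m < q n -> G m z -> ~ G n z.
    move=> /jump mn; rewrite /G/= !in_itv/= => /andP[_ zm] /andP[nz _].
    by have := lt_le_trans zm (le_trans mn (ltW nz)); rewrite ltxx.
  apply/trivIsetP => m n _ _ mn; rewrite -subset0 => z [Gmz Gnz].
  have [qmn|qnm|/qinj/eqP] := ltgtP (q m) (q n); last by rewrite (negbTE mn).
    exact: disj qmn Gmz Gnz.
  exact: disj qnm Gnz Gmz.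
have muGn n : lebesgue_measure (G n) = (k n)%:E.
  rewrite /G lebesgue_measure_itv/= lte_fin ltrDl k0.
  by rewrite -EFinB addrAC subrr add0r.
have mUG : measurable (\bigcup_n G n) by exact: bigcupT_measurable.
have muG : lebesgue_measure (\bigcup_n G n) = 1%E.
  rewrite measure_bigcup//; last by move=> n _; exact: mG.
  transitivity (K setT); last exact: probability_setT.
  rewrite (_ : K setT = K (\bigcup_n [set n])); last first.
    congr (K _).
    by apply/seteqP; split => // n _; exists n.
  rewrite [RHS]measure_bigcup//; last first.
    apply/trivIsetP => m n _ _ mn; rewrite -subset0 => i [/= -> /eqP].
    by rewrite (negbTE mn).
  by apply: eq_eseriesr => n _; rewrite -[RHS]fineK ?Kfin//; exact: muGn.
exists g, (`[0, 1] `\` \bigcup_n G n); split.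
- move=> x y /qdense[n /andP[xq qy]].
  rewrite (le_lt_trans (gmono _ _ (ltW xq)))//.
  by rewrite (lt_le_trans _ (jump n y qy))// ltrDl.
- exact: measurableD.
- rewrite measureD//=; last first.
    by rewrite lebesgue_measure_itv/= lte_fin ltr01 -EFinB ltry.
  rewrite setIidr; last by apply: bigcup_sub => n _; exact: G01.
  rewrite [X in (_ - X)%E]muG lebesgue_measure_itv/= lte_fin ltr01.
  by rewrite oppr0 adde0 subee.
- move=> y; split; first by rewrite /= in_itv/= g0 g1.
  by move=> [n _]; exact: Gg.
Qed.

(** * Laws and translations on the line *)

Lemma exists_law d (T : measurableType d) (R : realType) (P : probability T R)
    (X : T -> R) :
  measurable_fun [set: T] X ->
  exists nu : probability (measurableTypeR R) R,
    forall A, nu A = P (X @^-1` A).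
Proof.
move=> mX.
pose X' : T -> measurableTypeR R := X.
have mX' : measurable_fun [set: T] X' by [].
by exists (distribution P (mfun_Sub (mem_set mX'))).
Qed.

Lemma measurable_translate (R : realType) (t : R) :
  measurable_fun [set: R] (fun x : R => x + t).
Proof.
by apply: measurable_funD; [exact: measurable_id|exact: measurable_cst].
Qed.

Lemma lebesgue_measure_translate (R : realType) (t : R) (A : set R) :
  measurable A ->
  lebesgue_measure ((fun x => x + t) @^-1` A) = lebesgue_measure A.
Proof.
move=> mA.
change (pushforward lebesgue_measure
  (fun x : measurableTypeR R => x + t : measurableTypeR R) A
  = lebesgue_measure A).
apply/esym/lebesgue_measure_unique => //=.
  exact: measurable_translate.
move=> ? _ [[a b]] _ <-; rewrite /pushforward/=.
rewrite (_ : _ @^-1` _ = `]a - t, b - t]%classic).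
  by rewrite !lebesgue_measure_itv/= !lte_fin ltrD2r -!EFinB opprB addrA subrK.
by apply/seteqP; split => x /=; rewrite !in_itv/= ltrBlDr lerBrDr.
Qed.

(** By Fubini the integral over [t] of the [nu]-mass of [B - t] equals the
    integral over [x] against [nu] of the Lebesgue measure of [B - x], which
    vanishes. So almost every translate of [nu] gives no mass to [B], however
    singular [nu] may be. *)
Lemma exists_translate_null (R : realType)
    (nu : probability (measurableTypeR R) R) (B : set R) :
  measurable B -> lebesgue_measure B = 0%E ->
  exists t, nu ((fun x => x + t) @^-1` B) = 0%E.
Proof.
move=> mB B0.
pose A : set (measurableTypeR R * measurableTypeR R) :=
  (fun z : R * R => z.1 + z.2) @^-1` B.
have mA : measurable A.
  rewrite -[A]setTI.
  have : measurable_fun [set: R * R] (fun z : R * R => z.1 + z.2).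
    by apply: measurable_funD; [exact: measurable_fst|exact: measurable_snd].
  by move=> mf; exact: mf.
(* the section of A over x is a translate of B, hence null *)
have := indic_fubini_tonelli nu lebesgue_measure mA.
rewrite (indic_fubini_tonelli_FE _ mA) (indic_fubini_tonelli_GE _ mA).
rewrite integral0_eq; last first.
  move=> x _ /=; rewrite -B0 -[RHS](lebesgue_measure_translate _ x B)//.
  congr (lebesgue_measure _); apply/seteqP.
  by split => y; rewrite /= /xsection/= inE /A/= addrC.
move=> /esym I0.
have mI : measurable_fun setT (nu \o ysection A).
  exact: measurable_fun_ysection.
have [N [mN N0 sN]] :
    ae_eq (@lebesgue_measure R) setT (nu \o ysection A) (cst 0%E).
  apply/(ae_eq_integral_abs _ measurableT mI).
  by rewrite -[RHS]I0; apply: eq_integral => t _; rewrite gee0_abs.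
have [t tN] : exists t, ~ N t.
  apply/existsNP => NT; have : lebesgue_measure N = +oo%E.
    rewrite (_ : N = `]-oo, +oo[%classic); last first.
      by rewrite set_itvE; apply/seteqP; split.
    by rewrite lebesgue_measure_itv.
  by rewrite [X in X = _ -> _]N0.
exists t; have /contrapT := contra_not (sN t) tN.
move=> /(_ I) /=; apply: etrans.
by congr (nu _); apply/seteqP; split => y; rewrite /= /ysection/= inE.
Qed.

Lemma exists_conditional (R : realType) (nu : probability (measurableTypeR R) R)
    (E : set R) :
  measurable E -> (0 < nu E)%E ->
  exists nu' : probability (measurableTypeR R) R,
    forall A, nu' A = (nu (A `&` E) * (fine (nu E))^-1%:E)%E.
Proof.
move=> mE E0; have mE' : measurable (E : set (measurableTypeR R)) by [].
exists (mnormalize (mrestr nu mE') nu) => A /=.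
have nuET : mrestr nu mE' setT = nu E by rewrite /mrestr setTI.
rewrite /mnormalize [X in X == _]nuET [X in _ || (X == _)]nuET.
rewrite [X in fine X]nuET.
by rewrite gt_eqF//= lt_eqF// -ge0_fin_numE// fin_num_measure.
Qed.

(** * A singular atomless probability of full support *)

(** [nu] is the law of [q n + g u], with [n] random of full support in [nat],
    [u] uniform on [0, 1], [q] a dense sequence and [g] an increasing function
    whose range lies in the null set [C]. Injectivity of [g] excludes atoms, and
    [nu] lives on the union of the translates [q n + C], which is null. It
    charges each interval [I]: otherwise almost no [u] would satisfy
    [q n + g u \in I] for some [n], although all of them do by density. *)
Lemma exists_singular_prob (R : realType) :
  exists (nu : probability (measurableTypeR R) R) (M : set R),
    [/\ forall x : R, nu [set x] = 0%E,
        forall a b : R, a < b -> (0 < nu `]a, b[%classic)%E,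
        measurable M, lebesgue_measure M = 0%E & nu (~` M) = 0%E].
Proof.
have [q [_ qdense]] := dense_enumeration R.
have [K K0] := fully_supported_prob_nat R.
have [g [C [gincr mC C0 Cg]]] := increasing_null_range R.
have gnd : {homo g : x y / x <= y}.
  by move=> x y; rewrite le_eqVlt => /predU1P[->//|/gincr/ltW].
pose U : probability (measurableTypeR R) R := uniform_prob (@ltr01 R).
have U1 x : U [set x] = 0%E.
  apply: (null_content_dominatesP _ _).1 (dominates_uniform_prob _) _ _ _.
    exact: measurable_set1.
  exact: lebesgue_measure_set1.
pose P : probability (nat * measurableTypeR R)%type R := (K \x U)%E.
pose X : nat * measurableTypeR R -> R := fun z => q z.1 + g z.2.
have mX : measurable_fun [set: nat * measurableTypeR R] X.
  apply: measurable_funD.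
    by apply: (measurableT_comp (f := q)) => //; exact: measurable_fst.
  apply: (measurableT_comp (f := g : measurableTypeR R -> R)).
    exact: nondecreasing_measurable.
  exact: measurable_snd.
have PE A : P A = (\int[K]_n U (xsection A n))%E by [].
have P0 A : (forall n, U (xsection A n) = 0%E) -> P A = 0%E.
  by move=> A0; rewrite PE integral0_eq// => n _; exact: A0.
have mXA (A : set R) : measurable A -> measurable (X @^-1` A).
  by move=> mA; rewrite -[X in measurable X]setTI; exact: mX.
have [nu nuE] := exists_law _ _ _ P X mX.
exists nu, (\bigcup_n (fun x => x - q n) @^-1` C); split.
- move=> x; rewrite nuE; apply: P0 => n.
  have [[u gu]|ngu] := pselect (exists u, q n + g u = x).
    apply/eqP; rewrite -measure_le0 -(U1 u) le_measure ?inE//.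
    + by apply: measurable_xsection; apply: mXA; exact: measurable_set1.
    + move=> v /=; rewrite /xsection/= inE /= /X/= -gu => /addrI.
      by case: (ltgtP v u) => // /gincr + gvu; rewrite gvu ltxx.
  rewrite (_ : xsection _ _ = set0) ?measure0//.
  rewrite -subset0 => v; rewrite /xsection/= inE /X/= => xv.
  by apply: ngu; exists v.
- move=> a b ab; rewrite lt_neqAle measure_ge0 andbT; apply/eqP => ab0.
  pose I n : set (measurableTypeR R) := xsection (X @^-1` `]a, b[) n.
  have mI n : measurable (I n).
    by apply: measurable_xsection; apply: mXA; exact: measurable_itv.
  have I0 n : U (I n) = 0%E.
    have : (K [set n] * U (I n) <= 0)%E.
      rewrite -product_measure1E// ab0 nuE le_measure ?inE//.
      + exact: measurableX.
      + apply: mXA; exact: measurable_itv.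
      + by move=> [m u] [/= ->]; rewrite /I /xsection/= inE.
    apply: contraTeq; rewrite -ltNge => UI.
    by apply: mule_gt0 => //; rewrite lt0e UI measure_ge0.
  have : U setT = 0%E.
    apply: measure_negligible => //.
    have nI : U.-negligible (\bigcup_n I n).
      apply: negligible_bigcup => n; exists (I n).
      by split; [exact: mI|exact: I0|].
    apply: negligibleS nI => u _.
    have [n /andP[aqn qnb]] := qdense _ _ (etrans (ltrD2r (- g u) a b) ab).
    exists n => //=; rewrite /I /xsection/= inE /= in_itv/= /X/=.
    by rewrite -ltrBlDr aqn -ltrBrDr.
  by rewrite probability_setT => /eqP; rewrite onee_eq0.
- apply: bigcupT_measurable => n.
  by rewrite -[X in measurable X]setTI; exact: measurable_translate.
- apply: measure_negligible.
    apply: bigcupT_measurable => n.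
    by rewrite -[X in measurable X]setTI; exact: measurable_translate.
  apply: negligible_bigcup => n.
  exists ((fun x => x - q n) @^-1` C); split => //.
    by rewrite -[X in measurable X]setTI; exact: measurable_translate.
  exact: etrans (lebesgue_measure_translate _ _ _ mC) C0.
- rewrite nuE (_ : _ @^-1` _ = set0) ?measure0// -subset0 => -[n u] /=; apply.
  by exists n => //=; rewrite /X/= addrAC subrr add0r.
Qed.

(** * Distribution functions of atomless probabilities *)

Definition rcdf (R : realType) (nu : set (measurableTypeR R) -> \bar R)
    (x : R) : R := fine (nu `]-oo, x]%classic).

Section rcdf.
Context (R : realType) (nu : probability (measurableTypeR R) R).
Local Notation F := (rcdf R nu).

Lemma rcdfE x : (F x)%:E = nu `]-oo, x]%classic.
Proof. by rewrite /rcdf fineK// fin_num_measure. Qed.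

Lemma rcdf_ge0 x : 0 <= F x.
Proof. by rewrite /rcdf fine_ge0. Qed.

Lemma rcdf_le1 x : F x <= 1.
Proof. by rewrite -lee_fin rcdfE probability_le1. Qed.

Lemma rcdf_itvoc a b : a <= b -> nu `]a, b]%classic = (F b - F a)%:E.
Proof.
move=> ab; rewrite EFinB !rcdfE.
have -> : `]-oo, b]%classic = `]-oo, a] `|` `]a, b] :> set R.
  by rewrite -itv_bndbnd_setU// bnd_simp.
rewrite measureU//; first by rewrite addeAC subee ?add0e// fin_num_measure.
rewrite -subset0 => x /=; rewrite !in_itv/= => -[xa /andP[]].
by rewrite ltNge xa.
Qed.

Lemma rcdf_nd : {homo F : x y / x <= y}.
Proof.
by move=> a b ab; rewrite -subr_ge0 -lee_fin -rcdf_itvoc.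
Qed.

Let idR : measurableTypeR R -> R := idfun.

Let measurable_idR : measurable_fun setT idR.
Proof. exact: (@measurable_id _ (measurableTypeR R) setT). Qed.

Let RVid : {mfun measurableTypeR R >-> R} := mfun_Sub (mem_set measurable_idR).

Let rcdf_cdf : F = fine \o cdf (RVid : {RV nu >-> R}).
Proof. by []. Qed.

Lemma rcdf_right_continuous x : F r @[r --> x^'+] --> F x.
Proof.
rewrite rcdf_cdf; apply: fine_cvg => /=.
by rewrite fineK ?fin_num_measure//; exact: cdf_right_continuous.
Qed.

Lemma rcdf_cvgy : F r @[r --> +oo] --> (1 : R).
Proof. by rewrite rcdf_cdf; apply/fine_cvg; exact: cvg_cdfy1. Qed.

Lemma rcdf_cvgNy : F r @[r --> -oo] --> (0 : R).
Proof. by rewrite rcdf_cdf; apply/fine_cvg; exact: cvg_cdfNy0. Qed.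

End rcdf.

Section atomless.
Context (R : realType) (nu : probability (measurableTypeR R) R).
Local Notation F := (rcdf R nu).
Context (nu_set1 : forall x : R, nu [set x] = 0%E).

(** Left continuity at [x] is right continuity at [- x] of the distribution
    function of the reflected measure; passing between open and closed rays
    costs one atom, that is, nothing. *)
Lemma rcdf_continuous : continuous F.
Proof.
move=> x; apply/left_right_continuousP.
split; last exact: rcdf_right_continuous.
have mN : measurable_fun [set: R] (-%R : R -> R) by exact: measurable_funN.
have [nu' nu'E] := exists_law _ _ _ nu (-%R : R -> R) mN.
have FE y : F y = 1 - rcdf R nu' (- y).
  have nuo : nu `]-oo, y[%classic = (F y)%:E.
    rewrite rcdfE (_ : `]-oo, y]%classic = `]-oo, y[ `|` [set y]); last first.
      by rewrite setUitv1.
    rewrite measureU//.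
      by rewrite [X in (_ + X)%E](nu_set1 y) adde0.
    by rewrite -subset0 => z [/= zy zE]; move: zy; rewrite zE in_itv/= ltxx.
  apply: EFin_inj; rewrite EFinB (rcdfE R nu') nu'E.
  rewrite (_ : _ @^-1` _ = `[y, +oo[%classic); last first.
    by apply/seteqP; split => z /=; rewrite !in_itv/= andbT lerN2.
  rewrite -setCitvl probability_setC// [X in (_ - (_ - X))%E]nuo -!EFinB.
  by rewrite opprB addrC subrK.
apply/cvg_at_leftNP; rewrite FE.
rewrite (_ : _ \o _ = fun y => 1 - rcdf R nu' y); last first.
  by apply/funext => y /=; rewrite FE opprK.
apply: cvgB; first exact: cvg_cst.
exact: rcdf_right_continuous.
Qed.

Lemma rcdf_onto u : 0 < u < 1 -> exists x, F x = u.
Proof.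
move=> /andP[u0 u1].
have [a Fau] : exists a, F a < u.
  by apply: filter_ex (cvgr_lt _ (rcdf_cvgNy R nu) u u0).
have [b uFb] : exists b, u < F b.
  by apply: filter_ex (cvgr_gt _ (rcdf_cvgy R nu) u u1).
have ab : a <= b.
  rewrite leNgt; apply/negP => /ltW /(rcdf_nd R nu) Fba.
  by have := lt_le_trans (lt_trans Fau uFb) Fba; rewrite ltxx.
have [||c _ Fc] := @IVT R F a b u ab.
- by apply: continuous_subspaceT; exact: rcdf_continuous.
- by rewrite ge_min le_max (ltW Fau) (ltW uFb) orbT.
by exists c.
Qed.

Section quantile.
Context (h : R -> R) (hK : forall u : R, 0 < u < 1 -> F (h u) = u).

Let h_nd u v : 0 < u < 1 -> 0 < v < 1 -> u <= v -> h u <= h v.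
Proof.
rewrite le_eqVlt => u01 v01 /predU1P[->//|uv].
rewrite leNgt; apply/negP => /ltW /(rcdf_nd R nu).
by rewrite !hK// leNgt uv.
Qed.

Lemma measurable_quantile : measurable_fun (`](0 : R), 1[%classic : set R) h.
Proof.
move=> _; apply: (measurability _ (RGenCInfty.measurableE R)) => //=.
move=> _ [_ [r ->] <-].
apply: is_interval_measurable => s t /=; rewrite !in_itv/= !andbT.
move=> [/andP[s0 s1] rs] [/andP[t0 t1] rt] u /andP[su ut].
have u01 : 0 < u < 1 by rewrite (lt_le_trans s0)//= (le_lt_trans ut).
split; first by rewrite /= in_itv.
by rewrite /= in_itv/= andbT (le_trans rs)// h_nd// s0.
Qed.

(** A right inverse [h] of the distribution function transports Lebesgue measure
    on ]0, 1[ to [nu]: up to its end points, the set of [u] with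
    [a < h u <= b] is the interval between [F a] and [F b], and half-open
    intervals determine a finite measure. *)
Lemma law_quantile (A : set R) : measurable A ->
  nu A = lebesgue_measure (`]0, 1[ `&` h @^-1` A).
Proof.
pose I01 : set R := `]0, 1[%classic.
have m01 : measurable (I01 : set (measurableTypeR R)) by exact: measurable_itv.
(* h is constrained, hence known to be measurable, on ]0, 1[ only *)
pose h' : measurableTypeR R -> measurableTypeR R := h \_ I01.
have mh' : measurable_fun [set: measurableTypeR R] h'.
  exact: (measurable_restrictT h m01).1 measurable_quantile.
move=> mA.
transitivity (pushforward (mrestr lebesgue_measure m01) h' A); last first.
  rewrite /pushforward /mrestr; congr (lebesgue_measure _).
  apply/seteqP; split => u /= [].
    by rewrite /h' patchE => + u01; rewrite mem_set.
  by move=> u01 Ahu; split=> //; rewrite /h' patchE mem_set.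
apply: (@measure_unique _ _ (measurableTypeR R) R.-ocitv.-measurable
  (fun n => `]-n%:R, n%:R]%classic) _ _ _ _ nu _) => //.
- exact: ocitvI.
- by move=> n; exact: is_ocitv.
- exact: bigcup_itvT.
- move=> _ [[a b] _ <-] /=.
  rewrite /pushforward /mrestr.
  have [ab|ba] := leP a b; last first.
    rewrite set_itv_ge ?bnd_simp -?leNgt ?ltW// preimage_set0 set0I.
    by rewrite (measure0 nu) (measure0 lebesgue_measure).
  rewrite rcdf_itvoc//.
  have hab u : 0 < u < 1 -> h' u = h u.
    by move=> u01; rewrite /h' patchE mem_set// /I01/= in_itv.
  set W := _ `&` _.
  have mW : measurable W.
    by apply: measurableI => //; rewrite -[X in measurable X]setTI; exact: mh'.
  have Fab : F a <= F b by exact: rcdf_nd.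
  have subW : `]F a, F b[ `<=` W.
    move=> u /=; rewrite in_itv/= => /andP[au ub].
    have u01 : 0 < u < 1.
      by rewrite (le_lt_trans (rcdf_ge0 _ _ _) au) (lt_le_trans ub)// rcdf_le1.
    split; last by rewrite /I01/= in_itv.
    rewrite /= in_itv/= hab//; apply/andP; split; last apply: ltW.
      by rewrite ltNge; apply/negP => /(rcdf_nd R nu); rewrite hK// leNgt au.
    by rewrite ltNge; apply/negP => /(rcdf_nd R nu); rewrite hK// leNgt ub.
  have supW : W `<=` `[F a, F b].
    move=> u [/= + u01]; rewrite /I01/= in_itv/= in u01.
    rewrite !in_itv/= hab// => /andP[/ltW /(rcdf_nd R nu) + /(rcdf_nd R nu)].
    by rewrite hK// => -> ->.
  apply/eqP; rewrite eq_le; apply/andP; split.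
  + apply: (@le_trans _ _ (lebesgue_measure (`]F a, F b[%classic : set R))).
      rewrite lebesgue_measure_itv/= lte_fin; case: ltP => //.
      by rewrite lee_fin subr_le0.
    by apply: le_measure; rewrite ?inE//; exact: measurable_itv.
  + apply: (@le_trans _ _ (lebesgue_measure (`[F a, F b]%classic : set R))).
      by apply: le_measure; rewrite ?inE//; exact: measurable_itv.
    rewrite lebesgue_measure_itv/= lte_fin; case: ltP => //.
    by rewrite lee_fin subr_ge0.
- by move=> n; rewrite -ge0_fin_numE// fin_num_measure//; exact: measurable_itv.
Qed.

End quantile.

(** The distribution function sends a set carrying [nu] onto almost all of
    ]0, 1[: a value [u] can be missed only if its quantile [h u] falls outside
    [N], and the set of such [u] has Lebesgue measure [nu (~` N)]. Going through
    [h] replaces the image under [F] by a preimage, which is Borel. *)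
Lemma rcdf_image_conull (N : set R) : measurable N -> nu (~` N) = 0%E ->
  lebesgue_measure.-negligible (`]0, 1[ `\` F @` N).
Proof.
move=> mN N0.
have /choice[h hK] : forall u : R, exists x, 0 < u < 1 -> F x = u.
  move=> u; have [u01|u01] := pselect (0 < u < 1); last by exists 0.
  by have [x Fx] := rcdf_onto _ u01; exists x.
have mh A : measurable A -> measurable (`]0, 1[ `&` h @^-1` A).
  by move=> mA; apply: (measurable_quantile _ hK).
exists (`]0, 1[ `&` h @^-1` (~` N)); split.
- by apply: mh; exact: measurableC.
- by rewrite -(law_quantile _ hK)//; exact: measurableC.
- move=> u [u01 nFNu]; split => // Nhu; apply: nFNu.
  by exists (h u) => //; exact: hK.
Qed.
End atomless.

(** * Lebesgue measurable sets *)

Lemma borel_has_lebesgue_measure (R : realType) (A : set R) :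
  measurable A -> has_lebesgue_measure A (lebesgue_measure A).
Proof. by move=> mA; split=> //; exact: sub_caratheodory. Qed.

Lemma lebesgue_measurable_borel_subset (R : realType) (S : set R) :
  lebesgue_measurable S ->
  exists A : set R, [/\ measurable A, A `<=` S &
    lebesgue_measure A = completed_lebesgue_measure S].
Proof.
rewrite /lebesgue_measurable -completed_caratheodory_measurable.
rewrite g_sigma_completed_algebra_genE => -[A mA [Z [C [mC C0 ZC]]] <-].
exists A; split => //; apply/eqP; rewrite eq_le; apply/andP; split.
  exact: le_outer_measure.
apply: (@le_trans _ _ (lebesgue_measure (A `|` C))).
  by apply: le_outer_measure; exact: setUS.
by rewrite (le_trans (measureU2 _ _ _))// [X in (_ + X)%E]C0 adde0.
Qed.

Lemma has_lebesgue_measure1 (R : realType) (E : set R) :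
  E `<=` `[0, 1] -> lebesgue_measure.-negligible (`]0, 1[ `\` E) ->
  has_lebesgue_measure E 1%E.
Proof.
move=> E01 [C [mC C0 EC]].
have I1 (b1 b2 : bool) :
    lebesgue_measure ([set` Interval (BSide b1 0) (BSide b2 1)] : set R) = 1%E.
  by rewrite lebesgue_measure_itv/= lte_fin ltr01 oppr0 adde0.
have mI : measurable (`]0, 1[%classic : set R) by exact: measurable_itv.
split.
  rewrite /lebesgue_measurable -completed_caratheodory_measurable.
  rewrite g_sigma_completed_algebra_genE.
  exists (`]0, 1[%classic `\` C); first exact: measurableD.
  exists (E `&` (C `|` [set 0; 1])).
    apply: negligibleS (@subIsetr _ _ _) _.
    apply: negligibleU; first by exists C; split.
    exists [set 0; 1]; split => //.
      by apply: measurableU; exact: measurable_set1.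
    by apply: countable_lebesgue_measure0; exact/finite_set_countable.
  apply/seteqP; split => [x [[x01 nCx]|[]]//|x Ex].
    by apply: contrapT => nEx; apply: nCx; exact: EC.
  have [Cx|nCx] := pselect (C x); first by right; split=> //; left.
  have := E01 x Ex; rewrite /= in_itv/= !le_eqVlt.
  move=> /andP[/predU1P[x0|x0] /predU1P[x1|x1]].
  - by right; split => //; right; left.
  - by right; split => //; right; left.
  - by right; split => //; right; right.
  - by left; split => //; rewrite /= in_itv/= x0.
apply/eqP; rewrite eq_le; apply/andP; split.
  by rewrite -(I1 true false); exact: le_outer_measure.
rewrite -(I1 false true).
apply: (@le_trans _ _ (completed_lebesgue_measure (E `|` C))).
  apply: le_outer_measure => x x01.
  have [Ex|nEx] := pselect (E x); first by left.
  by right; exact: EC.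
apply: (le_trans (outer_measureU2 _ _ _)).
by rewrite [X in (_ + X)%E]C0 adde0.
Qed.

(** * Null sets mapped onto sets of full measure *)

Theorem theorem1p6 (R : realType) (S : set R) :
  S `<=` `[0, 1] -> has_lebesgue_measure S 1%E ->
  exists (f : R -> R) (N : set R),
    [/\ set_fun `[0, 1] `[0, 1] f,
        {in `[0, 1] &, {homo f : x y / x < y}},
        N `<=` S,
        has_lebesgue_measure N 0%E
      & has_lebesgue_measure (f @` N) 1%E].
Proof.
move=> S01 [mS S1].
have [A [mA AS]] := lebesgue_measurable_borel_subset _ _ mS; rewrite S1 => A1.
have A01 := subset_trans AS S01.
have m01 : measurable (`[0, 1]%classic : set R) by exact: measurable_itv.
have mB : measurable (`[0, 1] `\` A) by exact: measurableD.
have B0 : lebesgue_measure (`[0, 1] `\` A) = 0%E.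
  rewrite measureD//=; last first.
    by rewrite lebesgue_measure_itv/= lte_fin ltr01 -EFinB ltry.
  rewrite setIidr// [X in (_ - X)%E]A1 lebesgue_measure_itv/= lte_fin ltr01.
  by rewrite oppr0 adde0 subee.
have [nu0 [M [nu0a nu0s mM M0 nu0M]]] := exists_singular_prob R.
have [t nu0B] := exists_translate_null _ nu0 _ mB B0.
have [nu1 nu1E] := exists_law _ _ _ nu0 _ (measurable_translate R t).
have nu1s (a b : R) : a < b -> (0 < nu1 `]a, b[%classic)%E.
  move=> ab; rewrite nu1E (_ : _ @^-1` _ = `]a - t, b - t[%classic).
    by apply: nu0s; rewrite ltrD2r.
  by apply/seteqP; split => x /=; rewrite !in_itv/= ltrBlDr ltrBrDr.
have I0 : (0 < nu1 `[0%R, 1%R]%classic)%E.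
  apply: lt_le_trans (nu1s 0 1 ltr01) _; apply: le_measure; rewrite ?inE//.
  by move=> x /=; rewrite !in_itv/= => /andP[/ltW-> /ltW->].
have [nu nuE] := exists_conditional _ nu1 _ m01 I0.
have nu_null (Z : set R) :
    nu1 (Z `&` `[0%R, 1%R]) = 0%E -> nu Z = 0%E.
  by move=> Z0; rewrite nuE [X in (X * _)%E]Z0 mul0e.
have nu1a (x : R) : nu1 [set x] = 0%E.
  rewrite nu1E (_ : _ @^-1` _ = [set x - t]) ?nu0a//.
  by apply/seteqP; split => y /= => [<-|->]; rewrite ?addrK ?subrK.
have nua (x : R) : nu [set x] = 0%E.
  apply: nu_null.
  apply: measure_negligible.
    by apply: measurableI => //; exact: measurable_set1.
  exists [set x]; split; [exact: measurable_set1|exact: nu1a|exact: subIsetl].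
have nus (a b : R) : 0 <= a -> a < b -> b <= 1 -> (0 < nu `]a, b]%classic)%E.
  move=> a0 ab b1; rewrite nuE mule_gt0//.
    apply: lt_le_trans (nu1s _ _ ab) _; apply: le_measure; rewrite ?inE//.
    - by apply: measurableI => //; exact: measurable_itv.
    - move=> x /=; rewrite !in_itv/= => /andP[ax xb].
      by rewrite ax (ltW xb) (le_trans a0 (ltW ax)) (le_trans (ltW xb) b1).
  by rewrite lte_fin invr_gt0 fine_gt0// I0/= -ge0_fin_numE// fin_num_measure.
pose M' := (fun x => x - t) @^-1` M.
have mM' : measurable M'.
  by rewrite -[X in measurable X]setTI; exact: measurable_translate.
have mN : measurable (A `&` M') by exact: measurableI.
(* the part of the null carrier M' of nu1 inside S *)
exists (rcdf R nu), (A `&` M'); split.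
- by move=> x _ /=; rewrite in_itv/= rcdf_ge0 rcdf_le1.
- move=> x y; rewrite !in_itv/= => /andP[x0 _] /andP[_ y1] xy.
  by rewrite -subr_gt0 -lte_fin -rcdf_itvoc ?(ltW xy)//; exact: nus.
- by move=> x [/AS].
- have -> : (0%E : \bar R) = lebesgue_measure (A `&` M').
    apply/esym/measure_negligible => //.
    exists M'; split => //.
    exact: etrans (lebesgue_measure_translate _ _ _ mM) M0.
  exact: borel_has_lebesgue_measure.
- apply: has_lebesgue_measure1.
    by move=> _ [x _ <-] /=; rewrite in_itv/= rcdf_ge0 rcdf_le1.
  apply: rcdf_image_conull => //.
  apply: nu_null.
  apply: measure_negligible.
    by apply: measurableI => //; exact: measurableC.
  have nu1M' : nu1 (~` M') = 0%E.
    rewrite nu1E (_ : _ @^-1` _ = ~` M)//.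
    by apply/seteqP; split => x; rewrite /M'/= addrK.
  have nZ : nu1.-negligible ((`[0, 1] `\` A) `|` ~` M').
    apply: negligibleU.
      by exists (`[0, 1] `\` A); split => //; exact: etrans (nu1E _) nu0B.
    by exists (~` M'); split => //; exact: measurableC.
  apply: negligibleS nZ => x [nAM x01].
  have [Ax|nAx] := pselect (A x); last by left.
  by right => M'x; apply: nAM.
Qed.
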